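(* Let $R$ be a finite group of order $r$ and let $n$ be a positive integer. The number of subsets $S\subseteq R$ for which there exist a non-identity proper normal subgroup $N$ of $R$ with $|N|\le n$ and an automorphism $f\in\mathrm{Aut}(\Gamma(R,S))$ with $f\notin R$ and $f$ fixing setwise every $N$-orbit, is at most $2^{\,r-\frac{r/n-2}{3}\log_2(4/3)+(\log_2 r)^2+\log_2 r+\log_2 n-1}$.
   Context: For a finite group $R$ and $S\subseteq R$, the Cayley digraph $\Gamma(R,S)$ has vertex set $R$ and $(g,h)$ is an arc iff $hg^{-1}\in S$. $R$ and its subgroups are identified with their images under the right regular representation in $\mathrm{Sym}(R)$; thus $R\le\mathrm{Aut}(\Gamma(R,S))$ and the $N$-orbits are the cosets of $N$. *)

(* Defs.v *)
From mathcomp Require Import all_boot all_order all_algebra all_fingroup.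
From mathcomp Require Import reals exp.

Set Implicit Arguments.
Unset Strict Implicit.
Unset Printing Implicit Defensive.

Import Order.TTheory GRing.Theory Num.Theory GroupScope.

Definition digraph_aut (T : finType) (e : rel T) : {set {perm T}} :=
  [set f : {perm T} | [forall x, forall y, e (f x) (f y) == e x y]].

Lemma digraph_aut_group_set (T : finType) (e : rel T) :
  group_set (digraph_aut e).
Proof.
apply/group_setP; split=> [|f g].
  by rewrite inE; apply/forallP => x; apply/forallP => y; rewrite !perm1.
rewrite !inE => /forallP Hf /forallP Hg.
apply/forallP => x; apply/forallP => y; rewrite !permM.
by rewrite (eqP (forallP (Hg _) _)) (eqP (forallP (Hf _) _)).
Qed.
Canonical digraph_aut_group (T : finType) (e : rel T) : {group {perm T}} :=
  Group (digraph_aut_group_set e).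

Section Cayley.
Variable gT : finGroupType.

Definition cayley_digraph (S : {set gT}) : rel gT :=
  fun g h => h * g^-1 \in S.

Definition right_regular : {group {perm gT}} :=
  (actperm 'R @* [set: gT])%G.

Lemma right_regular_sub_aut (S : {set gT}) :
  right_regular \subset digraph_aut (cayley_digraph S).
Proof.
apply/fintype.subsetP => _ /morphimP[g _ _ ->]; rewrite inE.
apply/forallP => x; apply/forallP => y.
by rewrite !actpermE /= /cayley_digraph invMg mulgA mulgK.
Qed.

Definition fixes_orbits (N : {set gT}) (f : {perm gT}) : bool :=
  [forall x, f @: orbit 'R N x == orbit 'R N x].

(* For subgroups N the orbits of 'R are the left cosets x *: N. *)
Lemma fixes_orbitsE (N : {group gT}) (f : {perm gT}) :
  fixes_orbits N f = [forall x, f @: (x *: N) == x *: N].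
Proof. by apply: eq_forallb => x; rewrite orbitR. Qed.

Definition bad_connection_sets (n : nat) : {set {set gT}} :=
  [set S : {set gT} |
    [exists N : {group gT},
      [&& N <| [set: gT], N :!=: 1, N \proper [set: gT], (#|N| <= n)%N
        & [exists f : {perm gT},
            [&& f \in digraph_aut (cayley_digraph S),
                f \notin right_regular & fixes_orbits N f]]]]].

End Cayley.

Arguments right_regular gT : clear implicits.
Arguments bad_connection_sets gT n : clear implicits.

Definition log2 (K : realType) (x : K) : K := (ln x / ln 2)%R.

(* Main.v *)
(* If [f] fixes every [N]-coset and is not a right translation, then some [u], [v]
   in distinct cosets have [y = u v^-1] different from [y' = f(u) f(v)^-1], while
   [y] and [y'] lie in the same coset, which is not [N].  As [f] maps the common
   out-neighbours of [u] and [v] in each coset onto those of [f(u)] and [f(v)],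
   the numbers of [s] in [S :&: c] with [s y] in [S], resp. [s y'] in [S], agree
   for every coset [c].  The condition at [c] involves only the trace of [S] on
   the block made of [c] and [c y], and a random [S] satisfies it with
   probability at most 3/4.  At least a third of the cosets index pairwise
   disjoint blocks, so a given pair [y], [y'] accounts for at most
   2^r (3/4)^(r/3n) sets [S].  There are at most [r n] pairs, and at most
   r^(log2 r - 1) proper subgroups [N], since [N] has order at most r/2 and hence
   log2 r - 1 generators. *)
Require Import Defs.
From mathcomp Require Import all_boot all_order all_algebra all_fingroup.
From mathcomp Require Import reals exp.
From mathcomp Require Import zify ring lra.

Set Implicit Arguments.
Unset Strict Implicit.
Unset Printing Implicit Defensive.

Import Order.TTheory GRing.Theory Num.Theory.
Local Open Scope ring_scope.

(** * Counting families of subsets of a finite set *)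

Section Counting.
Local Open Scope nat_scope.

Lemma leq_card_bigcup (I T : finType) (P : pred I) (F : I -> {set T}) :
  #|\bigcup_(i | P i) F i| <= \sum_(i | P i) #|F i|.
Proof.
elim/big_rec2: _ => [|i m A _ leAm]; first by rewrite cards0.
by apply: leq_trans (leq_card_setU _ _) _; rewrite leq_add2l.
Qed.

(** The map [h] embeds [A] in its complement within [V]. With toggles as [h], this is how an event
    is shown to have probability at most 1/2. *)
Lemma double_card_le (T : finType) (A V : {set T}) (h : T -> T) :
  A \subset V -> {in A, forall x, h x \in V :\: A} -> {in A &, injective h} ->
  2 * #|A| <= #|V|.
Proof.
move=> sAV hA hinj; rewrite mul2n -addnn -{2}(card_in_imset hinj) -(cardsID A V).
apply: leq_add; first by rewrite (setIidPr sAV).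
by apply: subset_leq_card; apply/subsetP => _ /imsetP[x Ax ->]; apply: hA.
Qed.

Definition toggle (T : finType) (z : T) (S : {set T}) : {set T} :=
  [set w | (w \in S) (+) (w == z)].

Lemma in_toggle (T : finType) (z w : T) (S : {set T}) :
  (w \in toggle z S) = (w \in S) (+) (w == z).
Proof. by rewrite inE. Qed.

Lemma in_toggle_neq (T : finType) (z w : T) (S : {set T}) :
  w != z -> (w \in toggle z S) = (w \in S).
Proof. by rewrite in_toggle => /negPf->; rewrite addbF. Qed.

Lemma toggle_inj (T : finType) (z : T) : injective (toggle z).
Proof.
move=> A B eqAB; apply/setP => w.
by move/setP/(_ w): eqAB; rewrite !in_toggle => /addIb.
Qed.

Lemma toggle_sub (T : finType) (z : T) (S U : {set T}) :
  z \in U -> S \subset U -> toggle z S \subset U.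
Proof.
move=> Uz /subsetP sSU; apply/subsetP => w; rewrite in_toggle.
by case: (eqVneq w z) => [->|_] //; rewrite addbF => /sSU.
Qed.

Lemma card_toggle_in (T : finType) (z : T) (S : {set T}) (P : pred T) :
  P z -> #|[set s in toggle z S | P s]| <> #|[set s in S | P s]|.
Proof.
move=> Pz; rewrite (cardsD1 z [set s in toggle _ _ | _]) (cardsD1 z [set s in S | _]).
suff -> : [set s in toggle z S | P s] :\ z = [set s in S | P s] :\ z.
  by rewrite !inE Pz eqxx; case: (z \in S) => /=; lia.
by apply/setP => w; rewrite !inE; case: eqVneq; rewrite // addbF.
Qed.

(* Either the traces of [S] along [g] and [g'] coincide, which at [s0] ties
   [g s0] to [g' s0] and has probability at most 1/2; or they differ at some
   [s] depending only on [S :&: D], and toggling [s] breaks the equality of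
   cardinals, so that the equality has conditional probability at most 1/2. *)
Lemma block_card_le (T : finType) (C D : {set T}) (g g' : T -> T) (s0 : T) :
    [disjoint C & D] -> {in C, forall s, g s \in D} ->
    {in C, forall s, g' s \in D} -> s0 \in C -> g s0 != g' s0 ->
  4 * #|[set S : {set T} | (S \subset C :|: D) &&
          (#|[set s in S | (s \in C) && (g s \in S)]|
             == #|[set s in S | (s \in C) && (g' s \in S)]|)]|
    <= 3 * 2 ^ #|C :|: D|.
Proof.
move=> dCD gD g'D Cs0 neq0.
have CD s t : s \in C -> t \in D -> t != s.
  by move=> Cs Dt; apply/eqP => ets; move/disjointFr/(_ Cs): dCD; rewrite -ets Dt.
set F := [set S | _]; set V := powerset (C :|: D).
pose E := [set S in V | [forall s in C, (g s \in S) == (g' s \in S)]].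
pose w (S : {set T}) := odflt s0 [pick s in C | (g s \in S) != (g' s \in S)].
have wP S : S \in V :\: E -> w S \in C /\ (g (w S) \in S) != (g' (w S) \in S).
  rewrite /w => /setDP[VS]; case: pickP => [s /andP[] //|none] nE.
  case/negP: nE; rewrite inE VS /=.
  by apply/forall_inP => s Cs; move: (none s); rewrite /= Cs /= => /negbFE.
have FV : F \subset V by apply/subsetP => S; rewrite !inE => /andP[].
have EV : E \subset V by apply/subsetP => S; rewrite !inE => /andP[].
have cardV : #|V| = 2 ^ #|C :|: D| by rewrite card_powerset.
have tog_other S s t : s \in C -> t \in D -> (t \in toggle s S) = (t \in S).
  by move=> Cs Dt; rewrite in_toggle_neq ?CD.
have E2 : 2 * #|E| <= #|V|.
  (* Toggling [g s0], which differs from [g' s0], destroys the agreement of the traces at [s0]. *)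
  apply: (double_card_le (h := toggle (g s0))) => //; last first.
    by move=> A B _ _; apply: toggle_inj.
  move=> S; rewrite !inE => /andP[sS /forall_inP/(_ _ Cs0)/eqP eqS].
  rewrite toggle_sub ?sS // ?inE ?gD ?orbT // andbT negb_and orFb.
  apply/forall_inP => /(_ _ Cs0); rewrite !inE eqS eqxx.
  by rewrite (eq_sym _ (g s0)) (negPf neq0); case: (_ \in S).
have F2 : 2 * #|F :\: E| <= #|V :\: E|.
  (* The toggled point lies in [C], while [w] reads only the trace of [S] on [D]. So [w] is
     unchanged by the toggle, which makes the map injective. *)
  have wE S : S \in V :\: E -> toggle (w S) S \in V :\: E /\ w (toggle (w S) S) = w S.
    move=> VES; have [Cw nw] := wP _ VES.
    move: VES; rewrite !inE => /andP[_ sS]; split.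
      rewrite toggle_sub ?sS ?inE ?Cw // andbT /=.
      by apply/forall_inP => /(_ _ Cw); rewrite !tog_other ?gD ?g'D // (negPf nw).
    rewrite {1 3}/w; congr odflt; apply: eq_pick => s /=.
    by case Cs: (s \in C); rewrite //= !tog_other ?gD ?g'D.
  apply: (double_card_le (h := fun S => toggle (w S) S)).
  - by rewrite setSD.
  - move=> S /setDP[FS nES].
    have VES : S \in V :\: E by rewrite inE nES (subsetP FV).
    have [VES' _] := wE _ VES; have [Cw nw] := wP _ VES.
    rewrite inE VES' andbT inE negb_and negbK; apply/orP; right.
    move: VES FS; rewrite !inE => /andP[_ ->] /= /eqP eqS.
    apply/negP => /andP[_ /eqP].
    have eqP1 (k : T -> T) : {in C, forall s, k s \in D} ->
        [set s in toggle (w S) S | (s \in C) && (k s \in toggle (w S) S)]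
        = [set s in toggle (w S) S | (s \in C) && (k s \in S)].
      move=> kD; apply: eq_finset => s.
      by case Cs: (s \in C); rewrite ?andbF //= (tog_other _ _ (k s)) ?kD.
    have eqP2 (k : T -> T) : k (w S) \notin S ->
        [set s in toggle (w S) S | (s \in C) && (k s \in S)]
        = [set s in S | (s \in C) && (k s \in S)].
      move=> nk; apply/setP => s; rewrite !inE.
      by case: eqVneq => [->|_]; rewrite ?addbF // (negPf nk) !andbF.
    rewrite !eqP1 //.
    (* Exactly one of [g], [g'] sends [w S] into [S]; the toggle changes its count and keeps the
       other. *)
    case gS: (g (w S) \in S) nw; case g'S: (g' (w S) \in S) => // _.
      rewrite (eqP2 g') ?g'S // -eqS.
      by apply: card_toggle_in; rewrite Cw gS.
    rewrite (eqP2 g) ?gS // eqS => /esym.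
    by apply: card_toggle_in; rewrite Cw g'S.
  - move=> A B /setDP[FA nEA] /setDP[FB nEB] eqAB.
    have [|_ wA] := wE A; first by rewrite inE nEA (subsetP FV).
    have [|_ wB] := wE B; first by rewrite inE nEB (subsetP FV).
    have ww : w A = w B by rewrite -wA eqAB wB.
    by move: eqAB; rewrite ww => /toggle_inj.
(* The two halvings give 4|F| <= 4|E| + 2(|V| - |E|) = 2|V| + 2|E| <= 3|V|. *)
have := cardsID E F; have := cardsID E V; rewrite (setIidPr EV) -cardV.
have : #|F :&: E| <= #|E| by rewrite subset_leq_card ?subsetIr.
by lia.
Qed.

(** Independence of disjoint blocks: [S] is determined by its traces on [U i] and on [V :\: U i],
    and the conditions of the other blocks depend only on the second trace. *)
Lemma disjoint_blocks_card_le (T J : finType) (U : J -> {set T})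
    (P : J -> pred {set T}) (s : seq J) (V : {set T}) :
    uniq s -> {in s, forall i, U i \subset V} ->
    {in s &, forall i j, i != j -> [disjoint U i & U j]} ->
    {in s, forall i,
      4 * #|[set A : {set T} | (A \subset U i) && P i A]| <= 3 * 2 ^ #|U i|} ->
  4 ^ size s * #|[set S : {set T} | (S \subset V) &&
                   all (fun i => P i (S :&: U i)) s]|
    <= 3 ^ size s * 2 ^ #|V|.
Proof.
elim: s V => [|i s IHs] V /=.
  move=> _ _ _ _; rewrite !expn0 !mul1n -card_powerset.
  by apply: subset_leq_card; apply/subsetP => S; rewrite !inE andbT.
case/andP=> nis us UV dU Pi.
have si : i \in i :: s by rewrite mem_head.
have ss j : j \in s -> j \in i :: s by rewrite inE orbC => ->.
have dj j : j \in s -> [disjoint U j & U i].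
  by move=> sj; apply: (dU _ _ (ss _ sj) si); apply: contraNneq nis => <-.
set F := [set S | _].
set A := [set A : {set T} | (A \subset U i) && P i A].
set B := [set S : {set T} | (S \subset V :\: U i) &&
                   all (fun j => P j (S :&: U j)) s].
have leF : #|F| <= #|A| * #|B|.
  rewrite -cardsX -(card_in_imset (f := fun S : {set T} => (S :&: U i, S :\: U i))).
    apply: subset_leq_card; apply/subsetP => _ /imsetP[S + ->].
    rewrite !inE => /and3P[sS PS aS] /=.
    rewrite subsetIr PS setSD //=; apply/allP => j sj.
    suff -> : (S :\: U i) :&: U j = S :&: U j by apply: (allP aS).
    rewrite setIDAC; apply/setDidPl; rewrite disjoint_sym.
    by apply: disjointWr (subsetIr _ _) _; rewrite disjoint_sym dj.
  by move=> S S' _ _ [eI eD]; rewrite -(setID S (U i)) eI eD setID.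
have IH : 4 ^ size s * #|B| <= 3 ^ size s * 2 ^ #|V :\: U i|.
  apply: IHs => // [j sj|j k sj sk|j sj]; last by apply: Pi; rewrite ss.
    by rewrite subsetD UV ?ss // dj.
  by apply: dU; apply: ss.
have -> : 2 ^ #|V| = 2 ^ #|U i| * 2 ^ #|V :\: U i|.
  by rewrite -expnD -(cardsID (U i) V) (setIidPr (UV i si)).
rewrite !expnS; apply: leq_trans (leq_mul (leqnn _) leF) _.
by have := leq_mul (Pi i si) IH; rewrite mulnACA => /leq_trans; apply; rewrite mulnACA.
Qed.

(** For a maximal [I] disjoint from its image, the sets [I], [f @: I] and [f @^-1: I] cover [Q]: a
    point outside all three could be added to [I]. *)
Lemma ex_disjoint_image (Q : finType) (f : {perm Q}) :
  (forall c, f c != c) ->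
  exists I : {set Q}, [disjoint I & f @: I] /\ #|Q| <= 3 * #|I|.
Proof.
move=> fP.
have [|I /maxsetP[dI maxI]] := @ex_maxset Q (fun I => [disjoint I & f @: I]).
  by exists set0; rewrite -setI_eq0 set0I.
exists I; split=> //.
have -> : 3 * #|I| = #|I| + #|f @: I| + #|f @^-1: I|.
  by rewrite card_imset ?card_preimset; [lia | exact: perm_inj ..].
apply: leq_trans (leq_add (leq_card_setU _ _) (leqnn _)).
apply: leq_trans (leq_card_setU _ _).
rewrite -cardsT; apply: subset_leq_card; apply/subsetP => c _.
apply: contraT; rewrite !inE !negb_or => /andP[/andP[nI nfI] nf'I].
case/negP: nI; rewrite -(maxI (c |: I)) ?setU11 ?subsetUr //.
rewrite imsetU1 disjoints_subset; apply/subsetP => d; rewrite !inE negb_or.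
case/orP=> [/eqP->|Id]; first by rewrite eq_sym fP.
apply/andP; split; first by apply: contraNneq nf'I => <-.
by rewrite (disjointFr dI).
Qed.

End Counting.

(** * Generating sequences and the number of proper subgroups *)

Section Subgroups.
Local Open Scope nat_scope.
Local Open Scope group_scope.
Variable gT : finGroupType.
Implicit Types (G N : {group gT}) (f : {perm gT}) (S : {set gT}).

(** Generators of a maximal proper subgroup together with one element outside it generate [G], and
    this step at least doubles the order. *)
Lemma ex_small_generating_seq G :
  exists s : seq gT, <<[set x in s]>> = G /\ (2 ^ size s <= #|G|)%N.
Proof.
have [m] := ubnP #|G|; elim: m G => // m IHm G leGm.
have [G1 | ntG] := eqsVneq G 1.
  exists [::]; rewrite G1 cards1; split=> //.
  by apply/eqP; rewrite eqEsubset sub1G andbT gen_subG; apply/subsetP => x; rewrite inE.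
have [|M /maxgroupP[pMG maxM]] := @ex_maxgroup gT (fun M => M \proper G).
  by exists 1%G; rewrite properEneq sub1G eq_sym ntG.
have [s [defM sM]] : exists s : seq gT, <<[set x in s]>> = M /\ (2 ^ size s <= #|M|)%N.
  by apply: IHm; apply: leq_trans (proper_card pMG) _.
have [sMG [x Gx nMx]] := properP pMG.
have sMX : M \subset <<x |: [set y in s]>> by rewrite -defM genS // subsetUr.
exists (x :: s); split.
  rewrite set_cons; apply/eqP; rewrite eqEproper; apply/andP; split.
    rewrite gen_subG subUset sub1set Gx; apply: subset_trans sMG.
    by rewrite -gen_subG defM.
  apply/negP => /maxM /(_ sMX) eqM; case/negP: nMx.
  by rewrite -eqM mem_gen // setU11.
rewrite /= expnS mulnC -(Lagrange sMG); apply: leq_mul => //.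
by rewrite indexg_gt1 proper_subn.
Qed.

Lemma card_proper_subgroups_le :
  (#|[set N : {group gT} | N \proper [set: gT]]| * #|gT|
     <= #|gT| ^ trunc_log 2 #|gT|)%N.
Proof.
set A := [set N | _]; set L := trunc_log 2 _.
have sz N : N \in A -> (2 * #|N| <= #|gT|)%N.
  rewrite inE => pN; rewrite -cardsT -(Lagrange (subsetT N)) mulnC leq_mul //.
  by rewrite indexg_gt1 proper_subn.
have [->|[N0 AN0]] := set_0Vmem A; first by rewrite cards0.
have g2 : (1 < #|gT|)%N.
  by apply: leq_trans (sz _ AN0); have := cardG_gt0 N0; lia.
have L1 : (0 < L)%N by rewrite trunc_log_gt0.
pose gen (t : L.-1.-tuple gT) := <<[set x in t]>>%G.
have leA : (#|A| <= #|gT| ^ L.-1)%N.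
  rewrite -card_tuple -cardsT; apply: leq_trans (leq_imset_card gen _).
  apply: subset_leq_card; apply/subsetP => N /sz leN.
  have [s [defN leS]] := ex_small_generating_seq N.
  (* Since [2 ^ size s] is at most [#|N|], hence at most half of [#|gT|], one generator is saved.
     Shorter sequences are then padded with 1. *)
  have leL : (size s <= L.-1)%N.
    rewrite -ltnS prednK // -(trunc_expnK (p := 2) (size s).+1) //.
    by apply: leq_trunc_log; rewrite expnS; lia.
  have szt : size (s ++ nseq (L.-1 - size s) 1) == L.-1.
    by rewrite size_cat size_nseq subnKC.
  apply/imsetP; exists (Tuple szt) => //; apply: val_inj; rewrite /= -defN.
  apply/eqP; rewrite eqEsubset genS ?andbT; last first.
    by apply/subsetP => x; rewrite !inE mem_cat => ->.
  rewrite gen_subG; apply/subsetP => x; rewrite !inE mem_cat mem_nseq.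
  by case/orP=> [sx|/andP[_ /eqP->]]; rewrite ?group1 // mem_gen ?inE.
by rewrite -[X in (_ <= _ ^ X)%N](prednK L1) expnS mulnC leq_mul.
Qed.

(** * Automorphisms fixing the cosets of a normal subgroup *)

Section Normal.
Variable N : {group gT}.
Hypothesis nNT : N <| [set: gT].

Let normN x : x \in 'N(N).
Proof. by rewrite (subsetP (normal_norm nNT)) ?inE. Qed.

Let cosetM x z : coset N (x * z) = coset N x * coset N z.
Proof. by rewrite morphM. Qed.

Let coset_eq1 z : (coset N z == 1) = (z \in N).
Proof.
by apply/eqP/idP => [/(coset_idr (normN z))|/coset_id].
Qed.

Lemma fixes_orbits_coset f : fixes_orbits N f -> forall x, coset N (f x) = coset N x.
Proof.
rewrite fixes_orbitsE => /forallP fN x.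
have : f x \in f @: (x *: N) by rewrite imset_f // lcoset_refl.
rewrite (eqP (fN x)) => /lcosetP[n Nn ->].
by rewrite cosetM (coset_id Nn) mulg1.
Qed.

(* The common out-neighbours of [u] and [v] in a coset are mapped by [f] onto
   those of [f u] and [f v]; translating by [u] and [f u] puts them in [S]. *)
Lemma card_common_out f S u v (c : coset_of N) :
    f \in digraph_aut (cayley_digraph S) -> fixes_orbits N f ->
  #|[set s in S | (coset N s == c) && (s * (u * v^-1) \in S)]|
  = #|[set s in S | (coset N s == c) && (s * (f u * (f v)^-1) \in S)]|.
Proof.
rewrite inE => /forallP fA /fixes_orbits_coset fN.
have fE x z : (f z * (f x)^-1 \in S) = (z * x^-1 \in S).
  exact: (eqP (forallP (fA x) z)).
pose h s := f (s * u) * (f u)^-1.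
have hinj : injective h by move=> s t /mulIg/perm_inj/mulIg.
have hN s : coset N (h s) = coset N s.
  by rewrite cosetM morphV //= !fN cosetM mulgK.
rewrite -[in RHS](card_preimset _ hinj); congr #|pred_of_set _|; apply/setP => s.
by rewrite !inE hN /h !mulgA mulgVK !fE mulgK.
Qed.

(** Otherwise [u^-1 * f u] agrees at any two elements of distinct cosets. Comparing elements outside
    [N] with 1, and those of [N] with some [z] outside [N], makes it constant, so [f] is right
    multiplication by [f 1]. *)
Lemma ex_moved_quotient f :
    N \proper [set: gT] -> fixes_orbits N f -> f \notin right_regular gT ->
  exists u v, coset N u != coset N v /\ u * v^-1 != f u * (f v)^-1.
Proof.
move=> /properP[_ [z _ nNz]] fN nRf.
have [/existsP[u /existsP[v /andP[? ?]]] | noex] :=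
    boolP [exists u, exists v, (coset N u != coset N v) && (u * v^-1 != f u * (f v)^-1)].
  by exists u, v.
have fE u v : coset N u != coset N v -> u^-1 * f u = v^-1 * f v.
  move=> neq; move: noex; rewrite negb_exists => /forallP/(_ u).
  rewrite negb_exists => /forallP/(_ v); rewrite neq negbK => /eqP eq_uv.
  by rewrite -[v^-1](mulKg u) eq_uv !mulgA mulgVK.
case/negP: nRf; suff -> : f = actperm 'R (f 1) by rewrite mem_morphim ?inE.
have f1 v : v \notin N -> v^-1 * f v = f 1.
  move=> nNv; rewrite (fE v 1) ?invg1 ?mul1g // (coset_id (group1 N)) //.
  by rewrite coset_eq1.
apply/permP => v; rewrite actpermE /= -[LHS](mulKVg v); congr (v * _).
have [Nv|] := boolP (v \in N); last exact: f1.
by rewrite (fE v z) ?f1 // (coset_id Nv) // eq_sym coset_eq1.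
Qed.

(** The trace that [f] leaves on [S], stated without [f], so that a union bound over the pairs [y],
    [y'] suffices. *)
Definition balanced_sets y y' : {set {set gT}} :=
  [set S : {set gT} | [forall c : coset_of N,
     #|[set s in S | (coset N s == c) && (s * y \in S)]|
       == #|[set s in S | (coset N s == c) && (s * y' \in S)]|]].

(** Right multiplication by the coset of [y] is a fixed-point-free permutation [sigma] of the
    quotient. For [I] disjoint from its image under [sigma], the blocks made of [c] and [sigma c]
    with [c] in [I] are pairwise disjoint, and [k] is [#|I|]. *)
Lemma card_balanced_sets_le y y' :
    y \notin N -> y' \in y *: N -> y != y' ->
  exists k, (#|gT| <= 3 * k * #|N|)%N /\
    (4 ^ k * #|balanced_sets y y'| <= 3 ^ k * 2 ^ #|gT|)%N.
Proof.
move=> nNy /lcosetP[n Nn def_y'] neq.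
have cy' : coset N y' = coset N y by rewrite def_y' cosetM (coset_id Nn) mulg1.
pose sigma := perm (@mulIg (coset_of N) (coset N y)).
have sE c : sigma c = c * coset N y by rewrite permE.
have s_neq c : sigma c != c.
  by rewrite sE -{2}(mulg1 c) (inj_eq (@mulgI _ c)) coset_eq1.
have [I [dI leI]] := ex_disjoint_image s_neq.
pose C c := [set s | coset N s == c].
pose P (c : coset_of N) (S : {set gT}) :=
  #|[set s in S | (coset N s == c) && (s * y \in S)]|
       == #|[set s in S | (coset N s == c) && (s * y' \in S)]|.
have sC c s : s \in C c -> s * y \in C (sigma c).
  by rewrite !inE sE => /eqP <-; rewrite cosetM.
have sC' c s : s \in C c -> s * y' \in C (sigma c).
  by rewrite !inE sE => /eqP <-; rewrite cosetM cy'.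
have dC c d : c != d -> [disjoint C c & C d].
  move=> ncd; rewrite -setI_eq0; apply/eqP/setP => s; rewrite !inE.
  by apply: contraNF ncd => /andP[/eqP-> /eqP->].
exists #|I|; split.
  rewrite -cardsT -(Lagrange (subsetT N)) mulnC leq_mul // -card_quotient ?normal_norm //.
  by rewrite quotientT cardsT.
pose U c := C c :|: C (sigma c).
have := @disjoint_blocks_card_le _ _ U P (enum I) [set: gT].
rewrite -cardE cardsT => le; apply: leq_trans (le _ _ _ _).
- rewrite leq_mul //; apply: subset_leq_card; apply/subsetP => S.
  rewrite !inE subsetT => /forallP bS /=; apply/allP => c _.
  have PE w : {in C c, forall s, s * w \in C (sigma c)} ->
     [set s in S :&: U c | (coset N s == c) && (s * w \in S :&: U c)]
     = [set s in S | (coset N s == c) && (s * w \in S)].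
    move=> wC; apply/setP => s; rewrite !inE.
    case: (eqVneq (coset N s) c) => [cs|_]; rewrite ?andbF // orTb !andbT /=.
    have : s \in C c by rewrite inE cs.
    by move/wC; rewrite inE => ->; rewrite orbT andbT.
  by rewrite /P (PE _ (sC c)) (PE _ (sC' c)); apply: bS.
- exact: enum_uniq.
- by move=> c _; apply: subsetT.
- move=> c d; rewrite !mem_enum => Ic Id ncd.
  have nsc e e' : e \in I -> e' \in I -> e != sigma e'.
    move=> Ie Ie'; apply: contraTneq dI => ee.
    apply/pred0Pn; exists e; rewrite /= Ie ee; exact: imset_f.
  rewrite -setI_eq0; apply/eqP/setP => s; rewrite !inE; apply/negP.
  case/andP=> /orP[] /eqP->; rewrite ?(inj_eq perm_inj) (negPf ncd) ?orbF.
    by rewrite (negPf (nsc _ _ Ic Id)).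
  by rewrite eq_sym (negPf (nsc _ _ Id Ic)).
- move=> c _; have /set0Pn[s0 Cs0] : C c != set0.
    have [x _ def_c] := cosetP c; apply/set0Pn; exists x.
    by rewrite inE def_c.
  have dCs : [disjoint C c & C (sigma c)] by rewrite dC // eq_sym.
  have neq0 : s0 * y != s0 * y' by rewrite (inj_eq (@mulgI _ s0)).
  apply: leq_trans (block_card_le dCs (sC c) (sC' c) Cs0 neq0).
  rewrite leq_mul //; apply: subset_leq_card; apply/subsetP => S.
  rewrite !inE => /andP[-> ] /=.
  have CE k : [set s in S | (s \in C c) && (k s \in S)]
      = [set s in S | (coset N s == c) && (k s \in S)].
    by apply: eq_finset => s; rewrite inE.
  by rewrite /P !CE.
Qed.

End Normal.
End Subgroups.

(** * Base-two logarithms, the union bound and the final estimate *)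

Lemma powR_log2 (K : realType) (x : K) : 0 < x -> 2 `^ log2 x = x.
Proof.
move=> x_gt0; have ln2_gt0 : 0 < ln 2 :> K by rewrite ln_gt0 ?ltr1n.
by rewrite /powR pnatr_eq0 /= /log2 divfK ?lnK ?gt_eqF.
Qed.

Lemma log2_ge (K : realType) (m : nat) (x : K) : 2 ^+ m <= x -> m%:R <= log2 x.
Proof.
move=> le_x; have ln2_gt0 : 0 < ln 2 :> K by rewrite ln_gt0 ?ltr1n.
rewrite /log2 ler_pdivlMr // mulr_natl -lnXn ?ltr0n //.
by rewrite ler_ln // posrE ?exprn_gt0 ?ltr0n //; apply: lt_le_trans le_x; rewrite exprn_gt0 ?ltr0n.
Qed.

(** Recording [y'] as [y * m] with [m] in [N] makes the pairs for one [N] a product set, of size at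
    most r n. *)
Lemma bad_connection_sets_sub (gT : finGroupType) (n : nat) :
  bad_connection_sets gT n \subset
    \bigcup_(N : {group gT} | [&& (N <| [set: gT])%g, N \proper [set: gT] & (#|N| <= n)%N])
      \bigcup_(p in setX (~: N) (N :\ 1%g)) balanced_sets N p.1 (p.1 * p.2)%g.
Proof.
apply/fintype.subsetP => S; rewrite inE.
case/existsP=> N /and5P[nN _ pN leN /existsP[f /and3P[Af nRf fN]]].
have [u [v [nuv nef]]] := ex_moved_quotient nN pN fN nRf.
have normN x : x \in 'N(N)%g.
  by rewrite (fintype.subsetP (normal_norm nN)) ?inE.
have cuv : coset N (u * v^-1)%g = coset N (f u * (f v)^-1)%g.
  by rewrite !morphM ?morphV ?groupV //= !(fixes_orbits_coset nN fN).
apply/bigcupP; exists N; first by rewrite nN pN.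
apply/bigcupP; exists (u * v^-1, (u * v^-1)^-1 * (f u * (f v)^-1))%g.
  rewrite !inE /= -eq_mulVg1 nef /=; apply/andP; split.
    apply: contra nuv => /coset_id; rewrite morphM ?morphV ?groupV //= => /eqP.
    by rewrite -eq_mulgV1.
  by apply: (coset_idr (normN _)); rewrite morphM ?morphV ?groupV //= cuv mulVg.
by rewrite inE /= mulKVg; apply/forallP => c; rewrite (card_common_out nN _ _ _ Af).
Qed.

Lemma card_balanced_sets_powR (K : realType) (gT : finGroupType) (n : nat)
    (N : {group gT}) (y y' : gT) :
    (0 < n)%N -> (#|N| <= n)%N -> (N <| [set: gT])%g -> y \notin N ->
    y' \in (y *: N)%g -> y != y' ->
  #|balanced_sets N y y'|%:R
    <= 2 `^ (#|gT|%:R - #|gT|%:R / n%:R / 3 * log2 (4 / 3)) :> K.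
Proof.
move=> n_gt0 leN nN nNy y'N neq.
have [k [le_k le_bal]] := card_balanced_sets_le nN nNy y'N neq.
have lam_ge0 : 0 <= log2 (4 / 3) :> K.
  by apply: (@log2_ge _ 0); rewrite expr0; lra.
have lam_pow : 2 `^ log2 (4 / 3) = 4 / 3 :> K by rewrite powR_log2 //; lra.
have : #|balanced_sets N y y'|%:R <= 2 `^ (#|gT|%:R - k%:R * log2 (4 / 3)) :> K.
  rewrite powRB ?pnatr_eq0 ?implybT // (mulrC k%:R) powRrM lam_pow !powR_mulrn ?ler0n //; last lra.
  rewrite expr_div_n invf_div mulrA ler_pdivlMr ?exprn_gt0 ?ltr0n // mulrC.
  by move: le_bal; rewrite -(ler_nat K) !natrM !natrX (mulrC (2 ^+ _)).
(* It remains to see that k >= r/(3n), which follows from r <= 3k|N| <= 3kn. *)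
move=> /le_trans; apply; apply: ler_powR; first by rewrite ler1n.
rewrite lerD2l lerN2; apply: ler_wpM2r => //.
rewrite ler_pdivrMr // ler_pdivrMr ?ltr0n // -!natrM ler_nat.
by apply: leq_trans le_k _; nia.
Qed.

Theorem theorem2p5 (K : realType) (gT : finGroupType) (n : nat)
    (n_gt0 : (0 < n)%N) :
  let r : K := #|[set: gT]|%:R in
  #|bad_connection_sets gT n|%:R <=
    2 `^ (r - (r / n%:R - 2) / 3 * log2 (4 / 3)
          + log2 r ^+ 2 + log2 r + log2 n%:R - 1).
Proof.
cbv zeta; set r : K := #|[set: gT]|%:R; set B : K := 2 `^ (r - r / n%:R / 3 * log2 (4 / 3)).
set PN := [set N : {group gT} | N \proper [set: gT]].
have r_gt0 : 0 < r by rewrite ltr0n cardsT; apply/card_gt0P; exists 1%g.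
have le_bad : #|bad_connection_sets gT n|%:R <= #|PN|%:R * (r * n%:R * B).
  apply: le_trans (_ : (\sum_(N : {group gT} | [&& (N <| [set: gT])%g, N \proper [set: gT]
     & (#|N| <= n)%N]) \sum_(p in setX (~: N) (N :\ 1%g))
       #|balanced_sets N p.1 (p.1 * p.2)%g|)%N%:R <= _).
    rewrite ler_nat; apply: leq_trans (subset_leq_card (bad_connection_sets_sub _ _)) _.
    apply: leq_trans (leq_card_bigcup _ _) _.
    by apply: leq_sum => N _; apply: leq_card_bigcup.
  rewrite natr_sum mulr_natl -sumr_const.
  (* The right side sums a nonnegative constant over all proper subgroups; those that are not normal
     or have order above [n] are dropped. *)
  rewrite [leRHS](bigID (fun N : {group gT} => (N <| [set: gT])%g && (#|N| <= n)%N)) /=.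
  rewrite -[leLHS]addr0; apply: lerD; last first.
    by apply: sumr_ge0 => N _; rewrite !mulr_ge0 ?powR_ge0 // ltW.
  rewrite [leRHS](eq_bigl (fun N : {group gT} =>
     [&& (N <| [set: gT])%g, N \proper [set: gT] & (#|N| <= n)%N])); last first.
    by move=> N; rewrite inE andbCA.
  apply: ler_sum => N /and3P[nN pN leN].
  rewrite natr_sum; apply: le_trans (_ : \sum_(p in setX (~: N) (N :\ 1%g)) B <= _).
    apply: ler_sum => -[y m]; rewrite !inE /= => /and3P[nNy nm1 Nm].
    rewrite /B /r cardsT; apply: card_balanced_sets_powR => //.
      by rewrite mem_lcoset mulKg.
    by rewrite -{1}(mulg1 y) (inj_eq (@mulgI _ y)) eq_sym.
  rewrite sumr_const -[leLHS]mulr_natl ler_wpM2r ?powR_ge0 //.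
  rewrite cardsX -natrM ler_nat leq_mul //; first by rewrite cardsT max_card.
  by apply: leq_trans leN; rewrite subset_leq_card ?subD1set.
(* Without proper subgroups the count is 0. A proper subgroup forces r >= 2, hence log2 r >= 1. *)
have [PN0|[N0]] := set_0Vmem PN.
  by apply: le_trans le_bad _; rewrite PN0 cards0 mul0r powR_ge0.
rewrite inE => /proper_card ltN0.
have r_ge2 : 2 <= r by rewrite ler_nat; apply: leq_trans ltN0; rewrite ltnS cardG_gt0.
have l_ge1 : 1 <= log2 r by apply: (@log2_ge _ 1); rewrite expr1.
have lam_ge0 : 0 <= log2 (4 / 3) :> K.
  by apply: (@log2_ge _ 0); rewrite expr0; lra.
have le_PN : #|PN|%:R * r <= 2 `^ (log2 r ^+ 2).
  have := @card_proper_subgroups_le gT.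
  rewrite -(ler_nat K) natrM natrX -cardsT -/r => /le_trans; apply.
  have -> m : r ^+ m = 2 `^ (log2 r * m%:R).
    by rewrite powRrM powR_log2 // powR_mulrn ?ltW.
  apply: ler_powR; first by rewrite ler1n.
  rewrite expr2 ler_wpM2l //; first by apply: le_trans l_ge1.
  by apply: log2_ge; rewrite -natrX ler_nat trunc_logP ?cardG_gt0.
apply: le_trans le_bad _.
have -> : #|PN|%:R * (r * n%:R * B) = #|PN|%:R * r * (n%:R * B) by ring.
apply: le_trans (ler_wpM2r _ le_PN) _; first by rewrite mulr_ge0 ?powR_ge0.
rewrite -{1}(powR_log2 (_ : 0 < n%:R)) ?ltr0n // /B -!powRD ?pnatr_eq0 ?implybT //.
apply: ler_powR; first by rewrite ler1n.
(* The two exponents differ by (2/3) log2(4/3) + log2 r - 1, which is nonnegative. *)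
by nra.
Qed.
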